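(* Let $G$ be a finite group, let $\mathrm{Irr}(G)$ be the set of irreducible complex characters of $G$, and let $T(G)=\sum_{\chi\in \mathrm{Irr}(G)}\chi(1)$ be the sum of the degrees of all the irreducible complex representations of $G$ (up to isomorphism). Let $\alpha\in \mathrm{Aut}(G)$ and let $S_\alpha=\{g\in G \mid \alpha(g)=g^{-1}\}$. Then $T(G)\geq |S_\alpha|$.
   Context: $\mathrm{Aut}(G)$ denotes the automorphism group of $G$. *)

(* Defs.v *)
From HB Require Import structures.
From mathcomp Require Import all_boot all_order all_algebra all_fingroup.
From mathcomp Require Import all_solvable all_field all_character.

Set Implicit Arguments.
Unset Strict Implicit.
Unset Printing Implicit Defensive.

Import Order.TTheory GroupScope GRing.Theory Num.Theory.
Local Open Scope ring_scope.

(* The library develops complex characters over [algC], the algebraic complex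
   numbers: every complex representation of a finite group is realizable there,
   and ['chi[G]_i], for [i : Iirr G], runs over Irr(G) without repetition. *)
Definition sum_irr_degrees (gT : finGroupType) (G : {group gT}) : algC :=
  \sum_(i : Iirr G) 'chi[G]_i 1%g.

(* An element of [Aut G] is a permutation of the whole of [gT] fixing every
   point outside [G], hence the explicit restriction to [G] here. *)
Definition inverted_set (gT : finGroupType) (G : {group gT})
    (alpha : {perm gT}) : {set gT} :=
  [set g in G | alpha g == g^-1%g].

(* Main.v *)
(* Expanding the regular character counts [S_alpha] as the sum over [chi] of
   [chi 1 * e_chi], where [e_chi] is the average of [chi (g * alpha g)] over
   [G]; it remains to see that [`|e_chi| <= 1].  Let [rho] afford [chi].  By
   Schur, averaging [rho g *m B *m (rho (alpha g))^T] yields either only [0],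
   and then [e_chi = 0], or multiples of an invertible invariant form [X], and
   then [e_chi = \tr M / chi 1] for [M := X^T *m X^-1].  Now [M] intertwines
   [rho] with [rho \o alpha^2], so a power of [M] commutes with [rho] and is
   scalar; as [\det M = 1], [M] has finite order, so its trace is bounded by
   its size. *)

Require Import Defs.
From HB Require Import structures.
From mathcomp Require Import all_boot all_order all_algebra all_fingroup.
From mathcomp Require Import all_solvable all_field all_character.

Set Implicit Arguments.
Unset Strict Implicit.
Unset Printing Implicit Defensive.

Import Order.TTheory GroupScope GRing.Theory Num.Theory.
Local Open Scope ring_scope.

Lemma norm_mxtrace_unity_root n m (M : 'M[algC]_n) :
  (0 < m)%N -> M ^+ m = 1 -> `|\tr M| <= n%:R.
Proof.
(* [M] generates a representation of a cyclic group, to which the bound on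
   character values applies; doubling the order avoids ['Z_1 = 'Z_2]. *)
case: m => // m _ Mm1; pose p := m.*2.+2; pose f (x : 'Z_p) := M ^+ x.
have Mp1 : M ^+ p = 1 by rewrite /p -doubleS -muln2 exprM Mm1 expr1n.
have fP : mx_repr [set: 'Z_p] f.
  split=> [|x y _ _]; first by rewrite /f expr0.
  by rewrite /f -[_ *m _]exprD -[RHS](expr_mod _ Mp1).
pose rG := MxRepresentation fP.
have := char1_ge_norm (Zp1 : 'Z_p) (cfRepr_char rG).
by rewrite cfRepr1 cfunE inE mulr1n /= /f expr1.
Qed.

(** The sum commutes with every [rG h], so by Schur it is scalar over [algC]; comparing traces,
    where each summand contributes [\tr C], fixes the scalar. *)
Lemma Schur_average (gT : finGroupType) (G : {group gT}) n
    (rG : mx_representation algC G n) (C : 'M_n) :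
  mx_irreducible rG ->
  \sum_(g in G) rG g *m C *m rG g^-1%g = (#|G|%:R / n%:R * \tr C)%:M.
Proof.
move=> irrG; set A := (LHS).
have cA : centgmx rG A.
  apply/centgmxP=> h Gh; rewrite mulmx_suml mulmx_sumr.
  rewrite (reindex_inj (mulgI h)) /=; apply: eq_big => [g|g Gg].
    by rewrite groupMl.
  rewrite groupMl // in Gg.
  rewrite repr_mxM // invMg repr_mxM ?groupV // !mulmxA.
  by rewrite repr_mxKV.
have absG : mx_absolutely_irreducible rG by apply: groupC.
have /is_scalar_mxP[a defA] := mx_abs_irr_cent_scalar absG cA.
have /mx_irrP[n_gt0 _] := irrG.
have n_neq0 : n%:R != 0 :> algC by rewrite pnatr_eq0 -lt0n.
have : \tr A = #|G|%:R * \tr C.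
  rewrite raddf_sum /= (eq_bigr (fun _ => \tr C)) ?sumr_const ?mulr_natl //.
  move=> g Gg.
  by rewrite mxtrace_mulC mulmxA -repr_mxM ?groupV // mulVg repr_mx1 mul1mx.
rewrite defA mxtrace_scalar => /(congr1 (fun x => x / n%:R)).
by rewrite -[a *+ n]mulr_natr mulfK // => ->; rewrite mulrAC.
Qed.

Section TwistedIndicator.

Variables (gT : finGroupType) (G : {group gT}) (alpha : {perm gT}).
Hypothesis alpha_aut : alpha \in Aut G.
Variables (n : nat) (rG : mx_representation algC G n).
Hypothesis irrG : mx_irreducible rG.

Lemma Aut_memG x : x \in G -> alpha x \in G.
Proof. by move=> Gx; rewrite Aut_closed. Qed.

Lemma Aut_mulG : {in G &, {morph alpha : x y / (x * y)%g}}.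
Proof. by move: alpha_aut; rewrite inE => /andP[_ /morphicP]. Qed.

Lemma Aut_invG x : x \in G -> alpha x^-1%g = (alpha x)^-1%g.
Proof. exact: (morphV (autm_morphism alpha_aut)). Qed.

Definition twisted_form (B : 'M[algC]_n) : 'M_n :=
  \sum_(g in G) rG g *m B *m (rG (alpha g))^T.

Lemma twisted_form_inv B h : h \in G ->
  rG h *m twisted_form B *m (rG (alpha h))^T = twisted_form B.
Proof.
move=> Gh; rewrite /twisted_form mulmx_sumr mulmx_suml.
rewrite [RHS](reindex_inj (mulgI h)) /=; apply: eq_big => [g|g Gg].
  by rewrite groupMl.
rewrite Aut_mulG // !repr_mxM ?Aut_memG // trmx_mul.
by rewrite !mulmxA.
Qed.

(** For fixed [g], the [(i, j)] entry of the summand with [B = delta_mx j i] is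
    [rG g i j * rG (alpha g) j i], and these products add up to the trace of
    [rG g *m rG (alpha g)]. *)
Lemma sum_mxtrace_twist :
  \sum_(g in G) \tr (rG (g * alpha g)%g) =
  \sum_i \sum_j twisted_form (delta_mx j i) i j.
Proof.
under [RHS]eq_bigr => i _ do under eq_bigr => j _ do rewrite summxE.
under [RHS]eq_bigr => i _ do rewrite exchange_big.
rewrite [RHS]exchange_big; apply: eq_bigr => g Gg /=.
rewrite repr_mxM ?Aut_memG //; apply: eq_bigr => i _; rewrite mxE.
apply: eq_bigr => j _.
rewrite -mulmxA mxE (bigD1 j) //= big1 ?addr0 => [|k kj].
  rewrite mxE (bigD1 i) //= big1 ?addr0 => [|l li].
    by rewrite !mxE !eqxx mul1r.
  by rewrite mxE (negPf li) andbF mul0r.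
rewrite mxE big1 ?mulr0 // => l _.
by rewrite mxE (negPf kj) mul0r.
Qed.

Section InvariantForm.

Variable X : 'M[algC]_n.
Hypothesis X_neq0 : X != 0.
Hypothesis X_inv : forall h, h \in G -> rG h *m X *m (rG (alpha h))^T = X.

(** By invariance the row kernel of [X] is a submodule, so by irreducibility it is zero or
    everything; the latter would force [X = 0]. *)
Lemma invariant_form_unit : X \in unitmx.
Proof.
rewrite -row_free_unit -kermx_eq0; apply: contraNT X_neq0 => nzK.
have /mx_irrP[_ /(_ (kermx X))] := irrG; case/(_ _ nzK)/row_fullP=> [|L LK].
  apply/mxmoduleP=> h Gh; apply/sub_kermxP.
  have /X_inv : h^-1%g \in G by rewrite groupV.
  move/(congr1 (mulmx (rG h))); rewrite !mulmxA -repr_mxM ?groupV //.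
  rewrite mulgV repr_mx1 mul1mx => defX.
  by rewrite -mulmxA -defX mulmxA mulmx_ker mul0mx.
by rewrite -[X]mul1mx -LK -mulmxA mulmx_ker mulmx0.
Qed.

Let uX := invariant_form_unit.

Lemma repr_mx_twist_tr g : g \in G ->
  (rG (alpha g))^T = invmx X *m rG g^-1%g *m X.
Proof.
move=> Gg; rewrite -{2}(X_inv Gg) !mulmxA -(mulmxA (invmx X)).
rewrite -repr_mxM ?groupV // mulVg repr_mx1 mulmx1.
by rewrite mulVmx // mul1mx.
Qed.

(** Trading [(rG (alpha g))^T] for a conjugate of [rG g^-1] turns the twisted average of [B] into
    the ordinary Schur average of [B *m invmx X], times [X]. *)
Lemma twisted_formE B :
  twisted_form B = (#|G|%:R / n%:R * \tr (B *m invmx X)) *: X.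
Proof.
rewrite -mul_scalar_mx -(Schur_average _ irrG) mulmx_suml.
by apply: eq_bigr => g Gg; rewrite repr_mx_twist_tr // !mulmxA.
Qed.

Let M := X^T *m invmx X.

Lemma sum_mxtrace_twistE :
  \sum_(g in G) \tr (rG (g * alpha g)%g) = #|G|%:R / n%:R * \tr M.
Proof.
rewrite sum_mxtrace_twist.
have -> : \tr M = \sum_i \sum_j invmx X i j * X i j.
  rewrite exchange_big; apply: eq_bigr => i _; rewrite mxE.
  by apply: eq_bigr => j _; rewrite mxE mulrC.
rewrite mulr_sumr; apply: eq_bigr => i _; rewrite mulr_sumr.
apply: eq_bigr => j _; rewrite twisted_formE mxE mulrA; congr (_ * _ * _).
rewrite /mxtrace (bigD1 j) //= big1 ?addr0 => [|k kj].
  rewrite mxE (bigD1 i) //= big1 ?addr0 => [|l li].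
    by rewrite mxE !eqxx mul1r.
  by rewrite mxE (negPf li) andbF mul0r.
by rewrite mxE big1 // => l _; rewrite mxE (negPf kj) mul0r.
Qed.

(** Applying [repr_mx_twist_tr] at [alpha g], transposing, then applying it again at [g^-1]
    conjugates [rG g] by [X^T *m invmx X]. *)
Lemma invariant_form_intertwine g : g \in G ->
  rG (alpha (alpha g)) *m M = M *m rG g.
Proof.
move=> Gg; have Gag := Aut_memG Gg.
rewrite -[rG _]trmxK repr_mx_twist_tr // -Aut_invG //.
rewrite !trmx_mul repr_mx_twist_tr ?groupV // invgK trmx_inv.
rewrite /M !mulmxA (mulmxKV _) ?unitmx_tr //.
by rewrite mulmxK.
Qed.

Lemma invariant_form_order : exists2 m, (0 < m)%N & M ^+ m = 1.
Proof.
pose k := #[alpha]%g.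
have twk j g : g \in G ->
    rG (iter j (alpha \o alpha) g) *m M ^+ j = M ^+ j *m rG g.
  move=> Gg; elim: j => [|j IHj]; first by rewrite expr0 mulmx1 mul1mx.
  have Gj : iter j (alpha \o alpha) g \in G.
    by elim: (j) => //= j' ?; rewrite !Aut_memG.
  rewrite exprS /= [X in _ *m X](_ : _ = M *m M ^+ j) // mulmxA.
  by rewrite invariant_form_intertwine // -mulmxA IHj mulmxA.
have cM : centgmx rG (M ^+ k).
  apply/centgmxP=> g Gg; rewrite -twk //; congr (rG _ *m _).
  (* Iterating [alpha ^+ 2] as many times as the order of [alpha] gives the identity. *)
  rewrite (eq_iter (f' := alpha ^+ 2)%g); last first.
    by move=> x; rewrite /= expgS permM expg1.
  by rewrite -permX -expgM mulnC expgM expg_order expg1n perm1.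
have absG : mx_absolutely_irreducible rG by apply: groupC.
have /is_scalar_mxP[c defMk] := mx_abs_irr_cent_scalar absG cM.
have /mx_irrP[n_gt0 _] := irrG.
(* [M ^+ k] is the scalar [c], and its determinant [c ^+ n] is [(\det M) ^+ k = 1]. *)
exists (k * n)%N; first by rewrite muln_gt0 order_gt0.
have detM : \det M = 1.
  by rewrite det_mulmx det_tr -det_mulmx mulmxV // det1.
have : c ^+ n = 1.
  rewrite -det_scalar -defMk.
  elim: (k) => [|j IHj]; first by rewrite expr0 det1.
  by rewrite exprS [\det _]det_mulmx detM IHj mulr1.
rewrite exprM defMk => cn1.
have -> j : (c%:M : 'M_n) ^+ j = (c ^+ j)%:M.
  elim: j => [|j IHj]; first by rewrite !expr0.
  by rewrite !exprS IHj [LHS]mul_scalar_mx scale_scalar_mx.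
by rewrite cn1.
Qed.

End InvariantForm.

Lemma norm_sum_mxtrace_twist :
  `|\sum_(g in G) \tr (rG (g * alpha g)%g)| <= #|G|%:R.
Proof.
have [X0 | ] := boolP [forall i, forall j, twisted_form (delta_mx j i) == 0].
  rewrite sum_mxtrace_twist big1 ?normr0 ?ler0n // => i _.
  rewrite big1 // => j _; move/forallP/(_ i)/forallP/(_ j)/eqP: X0 => ->.
  by rewrite mxE.
case/forallPn=> i /forallPn[j nzX].
have invX := @twisted_form_inv (delta_mx j i).
rewrite (sum_mxtrace_twistE nzX invX).
have [m m_gt0 Mm] := invariant_form_order nzX invX.
have := norm_mxtrace_unity_root m_gt0 Mm.
have /mx_irrP[n_gt0 _] := irrG.
rewrite normrM normf_div !normr_nat => le_tr.
by rewrite mulrAC ler_pdivrMr ?ltr0n // ler_wpM2l ?ler0n.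
Qed.

End TwistedIndicator.

Theorem theorem3p1 (gT : finGroupType) (G : {group gT}) (alpha : {perm gT})
    (alpha_aut : alpha \in Aut G) :
  sum_irr_degrees G >= #|inverted_set G alpha|%:R.
Proof.
have G_gt0 : 0 < #|G|%:R :> algC by rewrite ltr0n cardG_gt0.
have Gm g : g \in G -> (g * alpha g)%g \in G.
  by move=> Gg; rewrite groupM ?(Aut_memG alpha_aut).
have cardS : #|G|%:R * #|inverted_set G alpha|%:R =
    \sum_(i : Iirr G) 'chi_i 1%g * \sum_(g in G) 'chi_i (g * alpha g)%g.
  rewrite mulr_natr -sumr_const; under [RHS]eq_bigr do rewrite mulr_sumr.
  rewrite exchange_big /= /inverted_set [LHS]big_mkcond /= [RHS]big_mkcond /=.
  apply: eq_bigr => g _; rewrite inE; case: (boolP (g \in G)) => //= Gg.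
  (* The regular character is [#|G|] at [1] and zero elsewhere, and [g * alpha g = 1] says exactly
     that [alpha] inverts [g]. *)
  transitivity (cfReg G (g * alpha g)%g).
    by rewrite cfRegE eq_sym eq_mulVg1 invgK; case: eqP.
  by rewrite cfReg_sum sum_cfunE; apply: eq_bigr => i _; rewrite cfunE.
(* The cardinality is replaced by its own norm, so that the triangle inequality applies to its
   expansion over the characters. *)
rewrite -(ler_pM2l G_gt0) -natrM -[X in X <= _]normr_nat natrM cardS mulr_sumr.
apply: le_trans (ler_norm_sum _ _ _) _; apply: ler_sum => i _.
rewrite normrM (ger0_norm (ltW (irr1_gt0 i))) mulrC.
rewrite ler_wpM2r ?(ltW (irr1_gt0 i)) //.
rewrite (eq_bigr (fun g => \tr ('Chi_i (g * alpha g)%g))).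
  apply: norm_sum_mxtrace_twist => //; exact: socle_irr.
by move=> g Gg; rewrite -irrRepr cfunE Gm // mulr1n.
Qed.
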